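(* Let $p\ge 1$, $k\in\{0,\ldots,p\}$, and let $\Pi = (\{1,\ldots,k\},\{k+1,\ldots,p\})$. Let $s$ be a scalarizing function for $\Pi$ and let $S = \{s_w : w\in\mathbb{R}^p_>\}$ be the weighted scalarization induced by $W=\mathbb{R}^p_>$ and $s$, where $s_w:\mathbb{R}^p_>\to\mathbb{R}$, $s_w(y) = s(w_1 y_1,\ldots,w_p y_p)$. Define $$\alpha := \sup_{y' \in \mathbb{R}^p_>} \ \inf_{s' \in S}\ \sup\left\{\max \left\{ \frac{y_1}{y'_1}, \ldots, \frac{y_k}{y'_k}, \frac{y'_{k+1}}{y_{k+1}},\ldots,\frac{y'_{p}}{y_{p}} \right\} \ \middle|\ y \in L(y',s')\right\}$$ and $$\beta := \inf_{\bar y \in \mathbb{R}^p_>} \ \sup \left\{\max \left\{ \frac{y^*_1}{\bar{y}_1}, \ldots, \frac{y^*_k}{\bar{y}_k}, \frac{\bar{y}_{k+1}}{y^*_{k+1}},\ldots,\frac{\bar{y}_{p}}{y^*_{p}} \right\}\ \middle|\ y^* \in L(\bar{y},s)\right\}.$$ Then $\alpha = \beta$.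
   Context: $\mathbb{R}^p_> = \{y \in \mathbb{R}^p : y_i > 0 \text{ for } i=1,\ldots,p\}$. For $\Pi = (\{1,\ldots,k\},\{k+1,\ldots,p\})$ and $y,y'\in\mathbb{R}^p$, $y <_\Pi y'$ means $y_i < y'_i$ for $i=1,\ldots,k$ and $y_i > y'_i$ for $i=k+1,\ldots,p$. A scalarizing function for $\Pi$ is a continuous function $s:\mathbb{R}^p_>\to\mathbb{R}$ such that $y <_\Pi y'$ for $y,y'\in\mathbb{R}^p_>$ implies $s(y)<s(y')$. The level set of a function $s$ at $y'\in\mathbb{R}^p_>$ is $L(y',s)=\{y\in\mathbb{R}^p_> : s(y)=s(y')\}$. Suprema and infima are taken in $[1,\infty]$ (the values may be $\infty$). *)

(* Defs.v *)
From HB Require Import structures.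
From mathcomp Require Import all_boot all_order all_algebra.
From mathcomp Require Import all_classical all_reals all_analysis.

Set Implicit Arguments.
Unset Strict Implicit.
Unset Printing Implicit Defensive.

Import Order.TTheory GRing.Theory Num.Theory.
Import numFieldNormedType.Exports.

Local Open Scope classical_set_scope.
Local Open Scope ring_scope.

(* Coordinates 1, ..., p are the ordinals 0, ..., p - 1 of 'I_p, so the
   partition ({1, ..., k}, {k+1, ..., p}) separates i < k from k <= i. *)

Definition pos_orthant (R : realType) (p : nat) : set 'rV[R]_p :=
  [set y | forall i : 'I_p, 0 < y 0 i].

Definition lt_Pi (R : realType) (p k : nat) (y y' : 'rV[R]_p) : Prop :=
  forall i : 'I_p, if (i < k)%N then y 0 i < y' 0 i else y' 0 i < y 0 i.

(* Functions on the positive orthant are represented by total functions on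
   R^p; everything below only depends on their values on the orthant. *)
Definition scalarizing (R : realType) (p k : nat) (s : 'rV[R]_p -> R) : Prop :=
  {within @pos_orthant R p, continuous s} /\
  forall y y' : 'rV[R]_p, pos_orthant y -> pos_orthant y' ->
    lt_Pi k y y' -> s y < s y'.

Definition weighted (R : realType) (p : nat) (s : 'rV[R]_p -> R)
    (w : 'rV[R]_p) : 'rV[R]_p -> R :=
  fun y => s (\row_i (w 0 i * y 0 i)).

Definition weighted_scalarization (R : realType) (p : nat)
    (s : 'rV[R]_p -> R) : set ('rV[R]_p -> R) :=
  [set weighted s w | w in @pos_orthant R p].

Definition level_set (R : realType) (p : nat) (y' : 'rV[R]_p)
    (s : 'rV[R]_p -> R) : set 'rV[R]_p :=
  [set y | pos_orthant y /\ s y = s y'].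

(* The default value -oo of the iterated maximum is irrelevant for p >= 1. *)
Definition max_ratio (R : realType) (p k : nat) (y y' : 'rV[R]_p) : \bar R :=
  \big[maxe/-oo%E]_(i < p)
    (if (i < k)%N then y 0 i / y' 0 i else y' 0 i / y 0 i)%:E.

(* For y' in the orthant and p >= 1, y' lies in its own level set and
   max_ratio k y' y' = 1, so this supremum lies in [1, +oo] and suprema and
   infima in \bar R of such values agree with those taken in [1, +oo]. *)
Definition level_sup (R : realType) (p k : nat) (y' : 'rV[R]_p)
    (s : 'rV[R]_p -> R) : \bar R :=
  ereal_sup [set max_ratio k y y' | y in level_set y' s].

Definition alpha (R : realType) (p k : nat) (s : 'rV[R]_p -> R) : \bar R :=
  ereal_sup [set ereal_inf [set level_sup k y' s'
                           | s' in weighted_scalarization s]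
            | y' in @pos_orthant R p].

Definition beta (R : realType) (p k : nat) (s : 'rV[R]_p -> R) : \bar R :=
  ereal_inf [set level_sup k ybar s | ybar in @pos_orthant R p].

(* Main.v *)
(** Coordinatewise scaling by a positive vector [w] is a bijection of the
    positive orthant which preserves all the ratios y_i / y'_i and maps the
    level set of s_w at y' onto the level set of s at w y'.  Hence the inner
    supremum for (y', s_w) equals the one for (w y', s).  As w varies, w y'
    runs through the whole orthant, so for every y' the infimum over the
    weights is already beta. *)
Require Import Defs.
From mathcomp Require Import all_boot all_order all_algebra.
From mathcomp Require Import all_classical all_reals all_analysis.

Set Implicit Arguments.
Unset Strict Implicit.
Unset Printing Implicit Defensive.

Import Order.TTheory GRing.Theory Num.Theory.
Local Open Scope classical_set_scope.
Local Open Scope ring_scope.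

Definition scale_row (R : realType) (p : nat) (w y : 'rV[R]_p) : 'rV[R]_p :=
  \row_i (w 0 i * y 0 i).

Definition inv_row (R : realType) (p : nat) (w : 'rV[R]_p) : 'rV[R]_p :=
  \row_i (w 0 i)^-1.

Lemma pos_orthant_scale (R : realType) (p : nat) (w y : 'rV[R]_p) :
  pos_orthant w -> pos_orthant y -> pos_orthant (scale_row w y).
Proof. by move=> w0 y0 i; rewrite mxE mulr_gt0. Qed.

Lemma pos_orthant_inv (R : realType) (p : nat) (w : 'rV[R]_p) :
  pos_orthant w -> pos_orthant (inv_row w).
Proof. by move=> w0 i; rewrite mxE invr_gt0. Qed.

Lemma scale_rowVK (R : realType) (p : nat) (w y : 'rV[R]_p) :
  pos_orthant w -> scale_row w (scale_row (inv_row w) y) = y.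
Proof.
by move=> w0; apply/rowP => i; rewrite !mxE mulVKf // gt_eqF.
Qed.

Lemma scale_rowC (R : realType) (p : nat) (w y : 'rV[R]_p) :
  scale_row w y = scale_row y w.
Proof. by apply/rowP => i; rewrite !mxE mulrC. Qed.

Lemma max_ratio_scale (R : realType) (p k : nat) (w y y' : 'rV[R]_p) :
  pos_orthant w ->
  max_ratio k (scale_row w y) (scale_row w y') = max_ratio k y y'.
Proof.
move=> w0; apply: eq_bigr => i _; have wN0 : w 0 i != 0 by rewrite gt_eqF.
(* In both branches the ratio splits off the factor [w 0 i / w 0 i], which is 1. *)
by rewrite !mxE -!mulf_div divff // !mul1r.
Qed.

Lemma level_sup_weighted (R : realType) (p k : nat) (s : 'rV[R]_p -> R)
    (w y' : 'rV[R]_p) : pos_orthant w ->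
  level_sup k y' (weighted s w) = level_sup k (scale_row w y') s.
Proof.
move=> w0; congr ereal_sup; apply/seteqP; split=> _ [y [y0 sy] <-].
- exists (scale_row w y); last exact: max_ratio_scale.
  by split=> //; exact: pos_orthant_scale.
(* A point of the level set of [s] at [scale_row w y'] is pulled back by the inverse weight. *)
- exists (scale_row (inv_row w) y).
    split; first exact: pos_orthant_scale (pos_orthant_inv w0) y0.
    by rewrite /weighted -!/(scale_row _ _) scale_rowVK.
  by rewrite -(max_ratio_scale _ _ _ w0) scale_rowVK.
Qed.

Lemma inf_level_sup_weighted (R : realType) (p k : nat) (s : 'rV[R]_p -> R)
    (y' : 'rV[R]_p) : pos_orthant y' ->
  ereal_inf [set level_sup k y' s' | s' in weighted_scalarization s]
    = beta k s.
Proof.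
move=> y'0; congr ereal_inf; apply/seteqP; split.
- move=> _ [_ [w w0 <-] <-]; exists (scale_row w y').
    exact: pos_orthant_scale.
  by rewrite level_sup_weighted.
- move=> _ [ybar ybar0 <-].
  (* The weight with coordinates [ybar 0 i / y' 0 i] carries [y'] to [ybar]. *)
  have w0 := pos_orthant_scale (pos_orthant_inv y'0) ybar0.
  exists (weighted s (scale_row (inv_row y') ybar)).
    by exists (scale_row (inv_row y') ybar).
  by rewrite level_sup_weighted // scale_rowC scale_rowVK.
Qed.

Theorem lemma5p2 (R : realType) (p k : nat) (hp : (1 <= p)%N) (hk : (k <= p)%N)
  (s : 'rV[R]_p -> R) (hs : scalarizing k s) :
  alpha k s = beta k s.
Proof.
(* With [beta] written as the supremum of a singleton, it remains to see that the infima form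
   exactly this singleton. *)
rewrite -[RHS]ereal_sup1; congr ereal_sup; apply/seteqP; split.
- by move=> _ [y' y'0 <-]; exact: inf_level_sup_weighted.
(* The value [beta] is attained because the orthant is nonempty: it contains the all-ones vector. *)
- move=> _ ->; have pos1 : pos_orthant (const_mx 1 : 'rV[R]_p).
    by move=> i; rewrite mxE ltr01.
  by exists (const_mx 1); last exact: inf_level_sup_weighted.
Qed.
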